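(* For integers $n\ge 1$ and $k\ge 0$ let $m_n$ be the number of Motzkin trees with $n$ vertices and let $p_{k,n}$ be the total number of $k$-protected vertices in all Motzkin trees with $n$ vertices, i.e. the number of pairs $(T,v)$ with $T$ a Motzkin tree on $n$ vertices and $v$ a $k$-protected vertex of $T$. Let $p_k=\lim_{n\to\infty}\frac{p_{k,n}}{n\,m_n}$ be the asymptotic proportion of $k$-protected vertices among all vertices of all Motzkin trees. Then these limits exist and, for every $k\ge 1$, $$p_k=\tfrac13\,p_{k-1}+\tfrac13\,p_{k-1}^2 .$$
   Context: A Motzkin tree (0-1-2 tree, unary-binary tree) is a rooted plane tree, with at least one vertex, in which every vertex has 0, 1 or 2 children (a single child carries no left/right distinction; two children are ordered). A leaf is a vertex with no children. The rank of a vertex $v$ is the length (number of edges) of the shortest path from $v$ to a leaf travelling strictly from parent to child; leaves have rank 0. A vertex is $k$-protected if its rank is at least $k$. *)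

(* Defs.v *)
From HB Require Import structures.
From mathcomp Require Import all_boot all_order all_algebra finmap.
From mathcomp Require Import all_classical all_reals all_analysis.
Set Implicit Arguments.
Unset Strict Implicit.
Unset Printing Implicit Defensive.
Import Order.TTheory GRing.Theory Num.Theory.
Import numFieldNormedType.Exports.
Local Open Scope classical_set_scope.

Inductive motzkin : Type :=
  | Leaf
  | Unary of motzkin
  | Binary of motzkin & motzkin.

Fixpoint motzkin_encode (t : motzkin) : GenTree.tree unit :=
  match t with
  | Leaf => GenTree.Node 0 [::]
  | Unary u => GenTree.Node 1 [:: motzkin_encode u]
  | Binary l r => GenTree.Node 2 [:: motzkin_encode l; motzkin_encode r]
  end.

Fixpoint motzkin_decode (e : GenTree.tree unit) : motzkin :=
  match e with
  | GenTree.Node _ [:: u] => Unary (motzkin_decode u)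
  | GenTree.Node _ [:: l; r] => Binary (motzkin_decode l) (motzkin_decode r)
  | _ => Leaf
  end.

Lemma motzkin_encodeK : cancel motzkin_encode motzkin_decode.
Proof. by elim=> [|u IHu|l IHl r IHr] //=; rewrite ?IHu ?IHl ?IHr. Qed.

HB.instance Definition _ := Choice.copy motzkin (can_type motzkin_encodeK).

(* A vertex is represented by its address: the word of child indices read along
   the path from the root. An only child has index 0; of two children, the
   first has index 0 and the second has index 1. *)
Fixpoint addresses (t : motzkin) : seq (seq nat) :=
  match t with
  | Leaf => [:: [::]]
  | Unary u => [::] :: map (cons 0) (addresses u)
  | Binary l r =>
      [::] :: map (cons 0) (addresses l) ++ map (cons 1) (addresses r)
  end.

Definition vertex (t : motzkin) : finType := seq_sub (addresses t).

Definition nvertices (t : motzkin) : nat := #|vertex t|.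

(* [child v w]: the vertex [w] is a child of the vertex [v]. *)
Definition child (t : motzkin) : rel (vertex t) :=
  fun v w => prefix (val v) (val w) && (size (val w) == (size (val v)).+1).

Definition is_leaf (t : motzkin) (v : vertex t) : bool :=
  [forall w : vertex t, ~~ child v w].

Definition leaf_at_distance (t : motzkin) (v : vertex t) (d : nat) : bool :=
  [exists p : d.-tuple (vertex t), path (@child t) v p && is_leaf (last v p)].

Lemma ex_leaf_at_distance (t : motzkin) (v : vertex t) :
  exists d, leaf_at_distance v d.
Proof.
pose P := [pred w | connect (@child t) v w].
have Pv : P v by exact: connect0.
have [w vw wmax] := arg_maxnP (fun w : vertex t => size (val w)) Pv.
have [p pp wE] := connectP vw.
exists (size p); apply/existsP; exists (in_tuple p) => /=.
rewrite pp -wE /=; apply/forallP => x; apply/negP => wx.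
have /wmax : P x by exact: connect_trans vw (connect1 wx).
by case/andP: wx => _ /eqP wxE; rewrite /= wxE ltnn.
Qed.

Definition rank (t : motzkin) (v : vertex t) : nat :=
  ex_minn (ex_leaf_at_distance v).

Definition protected (k : nat) (t : motzkin) (v : vertex t) : bool :=
  k <= rank v.

Definition trees_of_size (n : nat) : set motzkin :=
  [set t | nvertices t = n].

Definition protected_pairs (k n : nat) : set {t : motzkin & vertex t} :=
  [set tv | nvertices (tag tv) = n /\ protected k (tagged tv)].

(* [fset_set A] has the elements of [A] when [A] is finite, which holds here by
   [finite_trees_of_size] and [finite_protected_pairs] below. *)
Definition motzkin_count (n : nat) : nat := #|` fset_set (trees_of_size n)|.

Definition protected_count (k n : nat) : nat :=
  #|` fset_set (protected_pairs k n)|.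

Definition protected_ratio (R : realType) (k : nat) : R^nat :=
  fun n => ((protected_count k n)%:R / (n%:R * (motzkin_count n)%:R))%R.

Definition protected_proportion (R : realType) (k : nat) : R :=
  limn (protected_ratio R k).

Lemma uniq_addresses (t : motzkin) : uniq (addresses t).
Proof.
have cI (i : nat) : injective (cons i) by move=> ? ? [].
have nil_cons (i : nat) s : [::] \notin map (cons i) s by apply/mapP => -[].
elim: t => //= [u IHu|l IHl r IHr]; first by rewrite nil_cons map_inj_uniq.
rewrite mem_cat negb_or !nil_cons cat_uniq !map_inj_uniq // IHl IHr /=.
by rewrite andbT; apply/hasPn => x /mapP[y _ ->]; apply/mapP => -[].
Qed.

Lemma nverticesE (t : motzkin) : nvertices t = size (addresses t).
Proof. by rewrite /nvertices card_seq_sub // uniq_addresses. Qed.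

Lemma finite_trees_of_size (n : nat) : finite_set (trees_of_size n).
Proof.
pose S m := [set t | nvertices t <= m].
suff fS m : finite_set (S m).
  by apply: sub_finite_set (fS n) => t; rewrite /trees_of_size /S /= => ->.
elim: m => [|m IHm].
  apply: sub_finite_set (finite_set0 motzkin) => t.
  by rewrite /S /= nverticesE; case: t.
have fU : finite_set (Unary @` S m) by exact: finite_image.
have fB : finite_set ((fun lr => Binary lr.1 lr.2) @` (S m `*` S m)).
  by apply: finite_image; exact: finite_setX.
apply: (@sub_finite_set _ _ ([set Leaf] `|` (Unary @` S m) `|`
    ((fun lr => Binary lr.1 lr.2) @` (S m `*` S m)))); last first.
  by rewrite !finite_setU; split=> //; split=> //; exact: finite_set1.
move=> [|u|l r]; rewrite /S /= nverticesE /=.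
- by left; left.
- by rewrite size_map ltnS => um; left; right; exists u; rewrite //= nverticesE.
rewrite size_cat !size_map ltnS => lrm; right; exists (l, r) => //=.
by split; rewrite nverticesE; apply: leq_trans lrm; rewrite ?leq_addr ?leq_addl.
Qed.

Lemma finite_protected_pairs (k n : nat) : finite_set (protected_pairs k n).
Proof.
apply: (@sub_finite_set _ _
  (\bigcup_(t in trees_of_size n) (range (fun v => Tagged vertex v : {t : motzkin & vertex t})))).
  by move=> [t v] /= [tn _]; exists t => //; exists v.
apply: bigcup_finite => [|t _]; first exact: finite_trees_of_size.
by apply: finite_image; exact: finite_finset.
Qed.

(* Main.v *)
(** Let [M] be the generating function of Motzkin trees and [R_k] that of the trees
    whose root is [k]-protected, so that [M = X (1 + M + M^2)], [R_0 = M] and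
    [R_(k+1) = X (R_k + R_k^2)].  A tree with a marked [k]-protected vertex is a
    context with a tree counted by [R_k] plugged into it, so the total number of
    [k]-protected vertices has generating function [R_k C], where
    [C = 1 / (1 - X - 2 X M)].  The equation for [M] gives
    [(1 - 2 X - 3 X^2) C^2 = 1], hence the recurrence
    [(n+2) C_(n+2) = (2n+3) C_(n+1) + 3(n+1) C_n] (central trinomial coefficients),
    from which [3 - 2/(n+1) <= C_(n+1) / C_n <= 3].  Since
    [n m_n = (M C)_n = (C_(n+1) - C_n) / 2], each [C_(n-j) / (n m_n)] tends to
    [3^-j].  As [M(1/3) = 1], Scheffe's lemma yields
    [(R_k C)_n / (n m_n) --> R_k(1/3)], and the recurrence for [R_k] evaluated at
    [1/3] is the claim. *)
From HB Require Import structures.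
Require Import Defs.
From mathcomp Require Import all_boot all_order all_algebra finmap.
From mathcomp Require Import all_classical all_reals all_analysis.
From mathcomp Require Import zify ring lra.
Set Implicit Arguments.
Unset Strict Implicit.
Unset Printing Implicit Defensive.
Import Order.TTheory GRing.Theory Num.Theory.
Import numFieldNormedType.Exports.
Local Open Scope classical_set_scope.
Local Open Scope ring_scope.

(** * Formal power series *)

Section Fps.
Variable R : comNzRingType.

(* An alias of [nat -> R], so that its product is the Cauchy product. *)
Definition fps := nat -> R.

HB.instance Definition _ := GRing.Zmodule.copy fps (nat -> R).

Definition fps_mul (f g : fps) : fps :=
  fun n => \sum_(i < n.+1) f i * g (n - i)%N.

Definition fps_one : fps := fun n => (n == 0%N)%:R.

(** The [n]-th coefficient of a Cauchy product involves only coefficients of index at most [n], so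
    it agrees with that of a product of truncated polynomials. The ring axioms are inherited from
    [{poly R}] this way. *)
Let trunc N (f : fps) : {poly R} := \poly_(i < N) f i.

Let coef_trunc N f n : (n < N)%N -> (trunc N f)`_n = f n.
Proof. by move=> nN; rewrite coef_poly nN. Qed.

Let fps_mulE N f g n : (n < N)%N -> fps_mul f g n = (trunc N f * trunc N g)`_n.
Proof.
move=> nN; rewrite coefM; apply: eq_bigr => i _.
by rewrite !coef_trunc //; [exact: leq_ltn_trans (leq_subr _ _) nN|
  apply: leq_trans nN; exact: ltn_ord].
Qed.

Let fps_mulC : commutative fps_mul.
Proof.
by move=> f g; apply/funext => n; rewrite !(@fps_mulE n.+1)// mulrC.
Qed.

Let fps_mulA : associative fps_mul.
Proof.
have H f g h n : fps_mul f (fps_mul g h) n =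
    (trunc n.+1 f * (trunc n.+1 g * trunc n.+1 h))`_n.
  rewrite coefM; apply: eq_bigr => i _.
  by rewrite coef_trunc // (@fps_mulE n.+1) // ltnS leq_subr.
move=> f g h; apply/funext => n.
by rewrite (fps_mulC (fps_mul f g)) !H mulrA mulrC.
Qed.

Let fps_mul1 : left_id fps_one fps_mul.
Proof.
move=> f; apply/funext => n; rewrite /fps_mul big_ord_recl /= subn0 mul1r.
by rewrite big1 ?addr0 // => i _; rewrite mul0r.
Qed.

Let fps_mulD : left_distributive fps_mul +%R.
Proof.
move=> f g h; apply/funext => n; rewrite /fps_mul.
by under eq_bigr do rewrite mulrDl; rewrite big_split.
Qed.

Let fps_one_neq0 : fps_one != 0.
Proof. by apply/eqP => /(congr1 (fun f => f 0%N))/eqP; rewrite /= oner_eq0. Qed.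

HB.instance Definition _ := GRing.Zmodule_isComNzRing.Build fps
  fps_mulA fps_mulC fps_mul1 fps_mulD fps_one_neq0.

End Fps.

Section FpsTheory.
Variable R : comNzRingType.
Implicit Types f g : fps R.

Lemma coef_fpsM f g n : (f * g) n = \sum_(i < n.+1) f i * g (n - i)%N.
Proof. by []. Qed.

Lemma coef_fps1 n : (1 : fps R) n = (n == 0%N)%:R.
Proof. by []. Qed.

Lemma coef_fpsD f g n : (f + g) n = f n + g n.
Proof. by []. Qed.

Lemma coef_fpsB f g n : (f - g) n = f n - g n.
Proof. by []. Qed.

Lemma coef_fpsMn f n k : (f *+ k) n = f n *+ k.
Proof. by elim: k => [|k IH]; rewrite ?mulr0n // !mulrS -IH. Qed.

Definition fpsX : fps R := fun n => (n == 1%N)%:R.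

Lemma coef_fpsXM f n : (fpsX * f) n = if n is n'.+1 then f n' else 0.
Proof.
case: n => [|n]; rewrite coef_fpsM; first by rewrite big_ord_recl big_ord0 mul0r addr0.
rewrite !big_ord_recl /= mul0r mul1r add0r subn1 /=.
by rewrite big1 ?addr0 // => i _; rewrite mul0r.
Qed.

(** The Euler operator [X d/dX]: a derivation that, unlike [d/dX], does not shift indices. *)
Definition fps_theta f : fps R := fun n => n%:R * f n.

Lemma fps_thetaM f g :
  fps_theta (f * g) = fps_theta f * g + f * fps_theta g.
Proof.
apply/funext => n; rewrite coef_fpsD /fps_theta !coef_fpsM mulr_sumr -big_split.
apply: eq_bigr => i _ /=.
have -> : n%:R = (nat_of_ord i)%:R + (n - i)%:R :> R.
  by rewrite -natrD subnKC // -ltnS.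
ring.
Qed.

Lemma fps_thetaD f g : fps_theta (f + g) = fps_theta f + fps_theta g.
Proof. by apply/funext => n; rewrite !coef_fpsD /fps_theta mulrDr. Qed.

Lemma fps_theta1 : fps_theta 1 = 0.
Proof. by apply/funext => -[|n]; rewrite /fps_theta ?mul0r // mulr0. Qed.

Lemma fps_thetaX : fps_theta fpsX = fpsX.
Proof. by apply/funext => -[|[|n]]; rewrite /fps_theta ?mul0r ?mulr0 ?mulr1. Qed.

End FpsTheory.

(** * Rank and subtrees *)

(** A recursive counterpart of the shortest path to a leaf; [rankE] proves that the two agree. *)
Fixpoint root_rank (t : motzkin) : nat :=
  match t with
  | Leaf => 0
  | Unary u => (root_rank u).+1
  | Binary l r => (minn (root_rank l) (root_rank r)).+1
  end.

(* [subtree t a] is meaningful only when [a] is an address of [t]. *)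
Fixpoint subtree (t : motzkin) (a : seq nat) : motzkin :=
  match t, a with
  | Unary u, 0%N :: b => subtree u b
  | Binary l _, 0%N :: b => subtree l b
  | Binary _ r, 1%N :: b => subtree r b
  | _, _ => t
  end.

Lemma nil_addresses t : [::] \in addresses t.
Proof. by case: t. Qed.

Lemma subtree0 t : subtree t [::] = t.
Proof. by case: t. Qed.

Lemma mem_map_cons (i j : nat) a (s : seq (seq nat)) :
  (i :: a \in map (cons j) s) = (i == j) && (a \in s).
Proof.
apply/mapP/andP => [[b bs [-> ->]]|[/eqP-> as_]]; first by rewrite eqxx.
by exists a.
Qed.

Lemma addresses_cat t a b : a \in addresses t ->
  (a ++ b \in addresses t) = (b \in addresses (subtree t a)).
Proof.
elim: t a => [|u IHu|l IHl r IHr] [|i a] //=;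
  rewrite !in_cons /= ?mem_cat !mem_map_cons //.
- by case: i => [|i] //= /IHu.
- by case: i => [|[|i]] //=; rewrite ?orbF; [move/IHl|move/IHr].
Qed.

Lemma subtree_cat t a b : a \in addresses t ->
  subtree t (a ++ b) = subtree (subtree t a) b.
Proof.
elim: t a => [|u IHu|l IHl r IHr] [|i a] //=;
  rewrite !in_cons /= ?mem_cat !mem_map_cons //.
- by case: i => [|i] //= /IHu.
- by case: i => [|[|i]] //=; rewrite ?orbF; [move/IHl|move/IHr].
Qed.

(** Together with [root_rank_attained]: one plus the minimum over the children, in terms of
    addresses, as the path arguments need it. *)
Lemma root_rank_le t i : [:: i] \in addresses t ->
  (root_rank t <= (root_rank (subtree t [:: i])).+1)%N.
Proof.
case: t => [|u|l r] //=; rewrite !in_cons /= ?mem_cat !mem_map_cons.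
- by case: i => //= _; rewrite subtree0.
- by case: i => [|[|i]] //= _; rewrite subtree0 ltnS ?geq_minl ?geq_minr.
Qed.

Lemma root_rank_attained t : t <> Leaf -> exists2 i, [:: i] \in addresses t &
  root_rank t = (root_rank (subtree t [:: i])).+1.
Proof.
case: t => [|u|l r] // _.
  by exists 0%N => /=; rewrite ?subtree0 // in_cons mem_map_cons nil_addresses.
have [lr|rl] := leqP (root_rank l) (root_rank r).
  exists 0%N => /=; last by rewrite subtree0; congr S; apply/minn_idPl.
  by rewrite in_cons mem_cat !mem_map_cons !nil_addresses.
exists 1%N => /=; last by rewrite subtree0; congr S; apply/minn_idPr/ltnW.
by rewrite in_cons mem_cat !mem_map_cons !nil_addresses.
Qed.

Section Rank.
Variable t : motzkin.
Implicit Types v w : vertex t.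

Lemma childP v w : reflect (exists2 i, [:: i] \in addresses (subtree t (val v)) &
  val w = rcons (val v) i) (child v w).
Proof.
apply: (iffP andP) => [[/prefixP[s ws]]|[i _ ws]]; last first.
  by rewrite ws size_rcons eqxx -cats1 prefix_prefix.
rewrite ws size_cat -addn1 eqn_add2l => /eqP.
case: s ws => [|i []] // ws _; exists i; last by rewrite cats1.
by rewrite -addresses_cat -?ws ?(valP w) // (valP v).
Qed.

Lemma child_subtree v i : [:: i] \in addresses (subtree t (val v)) ->
  exists2 w, child v w & subtree t (val w) = subtree (subtree t (val v)) [:: i].
Proof.
move=> i_in; have vt : val v \in addresses t := valP v.
have wt : rcons (val v) i \in addresses t by rewrite -cats1 addresses_cat.
exists (SeqSub wt); first by apply/childP; exists i.
by rewrite /= -cats1 subtree_cat.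
Qed.

Lemma is_leafE v : is_leaf v = (subtree t (val v) == Leaf).
Proof.
apply/forallP/eqP => [vleaf|vleaf w]; last first.
  by apply/negP => /childP[i]; rewrite vleaf.
apply: contrapT => /root_rank_attained[i i_in _].
by have [w vw _] := child_subtree i_in; move: (vleaf w); rewrite vw.
Qed.

(** A step to a child lowers the root rank by at most one, and the path ends at root rank 0. *)
Lemma root_rank_path v p : path (@child t) v p -> is_leaf (last v p) ->
  (root_rank (subtree t (val v)) <= size p)%N.
Proof.
elim: p v => [|w p IHp] v /=; first by rewrite is_leafE => _ /eqP->.
move=> /andP[/childP[i i_in wv] pp] /(IHp _ pp).
rewrite wv -cats1 subtree_cat ?(valP v) // -ltnS.
exact/leq_trans/(root_rank_le i_in).
Qed.

(** Descending each time to a child that attains the minimum lowers the root rank by exactly one,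
    hence the induction on its value. *)
Lemma path_root_rank v : exists2 p, path (@child t) v p /\ is_leaf (last v p) &
  size p = root_rank (subtree t (val v)).
Proof.
move: {2}(root_rank _) (erefl (root_rank (subtree t (val v)))) => n.
elim: n v => [|n IHn] v vn.
  exists [::] => //; split=> //=.
  by rewrite is_leafE; case: (subtree t _) vn.
have /root_rank_attained[i i_in iE] : subtree t (val v) <> Leaf.
  by move=> E; rewrite E in vn.
have [w vw wE] := child_subtree i_in.
have [|p [pp pl] sp] := IHn w; first by move: vn; rewrite iE wE => -[].
by exists (w :: p); rewrite /= ?vw // sp wE -iE.
Qed.

Lemma rankE v : rank v = root_rank (subtree t (val v)).
Proof.
rewrite /rank; case: ex_minnP => m /existsP[p /andP[pp pl]] mmin.
apply/eqP; rewrite eqn_leq; have := root_rank_path pp pl; rewrite size_tuple => ->.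
have [q [qp ql] <-] := path_root_rank v; rewrite andbT; apply: mmin.
by apply/existsP; exists (in_tuple q); rewrite /= qp.
Qed.

End Rank.

(** * Protected vertices counted tree by tree *)

Definition num_protected (k : nat) (t : motzkin) : nat :=
  count (fun a => (k <= root_rank (subtree t a))%N) (addresses t).

Lemma card_protected k t : #|[pred v : vertex t | protected k v]| = num_protected k t.
Proof.
rewrite cardE -(size_map val) /num_protected -size_filter; apply: perm_size.
apply: uniq_perm.
- by rewrite map_inj_uniq ?enum_uniq //; exact: val_inj.
- by rewrite filter_uniq ?uniq_addresses.
move=> a; rewrite mem_filter; apply/mapP/andP => [[v]|[ka at_]].
  rewrite mem_enum inE /protected rankE => kv ->; split=> //; exact: (valP v).
by exists (SeqSub at_); rewrite // mem_enum inE /protected rankE.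
Qed.

Lemma num_protected_Unary k u :
  num_protected k (Unary u) = ((k <= root_rank (Unary u)) + num_protected k u)%N.
Proof. by rewrite /num_protected /= count_map. Qed.

Lemma num_protected_Binary k l r : num_protected k (Binary l r) =
  ((k <= root_rank (Binary l r)) + (num_protected k l + num_protected k r))%N.
Proof. by rewrite /num_protected /= count_cat !count_map. Qed.

Lemma num_protected0 t : num_protected 0 t = nvertices t.
Proof. by rewrite nverticesE /num_protected (eq_count (a2 := predT)) ?count_predT. Qed.

Lemma mem_trees n t : (t \in fset_set (trees_of_size n)) = (nvertices t == n).
Proof.
rewrite in_fset_set; last exact: finite_trees_of_size.
by apply/idP/eqP; rewrite inE.
Qed.

Lemma protected_countE k n : protected_count k n =
  (\sum_(t <- fset_set (trees_of_size n)) num_protected k t)%N.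
Proof.
pose s := [seq (Tagged vertex v : {t : motzkin & vertex t}) |
  t <- fset_set (trees_of_size n), v <- enum [pred v : vertex t | protected k v]].
have -> : protected_count k n = size s.
  rewrite /protected_count; apply: perm_size; apply: uniq_perm.
  - exact: fset_uniq.
  - apply: allpairs_uniq_dep; first exact: fset_uniq.
    + by move=> t _; exact: enum_uniq.
    + by move=> [x y] [x' y'] _ _.
  move=> [t v]; rewrite in_fset_set; last exact: finite_protected_pairs.
  apply/idP/allpairsPdep => /=.
    rewrite inE /= => -[tn kv]; exists t, v; split=> //.
      by rewrite mem_trees tn.
    by rewrite mem_enum.
  move=> [t' [v' []]]; rewrite mem_trees mem_enum => /eqP t'n kv' ->.
  by rewrite inE.
rewrite size_allpairs_dep sumnE big_map; apply: eq_bigr => t _.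
by rewrite -cardE card_protected.
Qed.

(** * Generating functions of trees *)

Lemma nvertices_Unary u : nvertices (Unary u) = (nvertices u).+1.
Proof. by rewrite !nverticesE /= size_map. Qed.

Lemma nvertices_Binary l r :
  nvertices (Binary l r) = (nvertices l + nvertices r).+1.
Proof. by rewrite !nverticesE /= size_cat !size_map. Qed.

Lemma trees0 : fset_set (trees_of_size 0) = [::] :> seq motzkin.
Proof.
apply/nilP; rewrite /nilp -leqn0 leqNgt -has_predT; apply/negP => /hasP[t].
by rewrite mem_trees nverticesE; case: t.
Qed.

Lemma trees1 : fset_set (trees_of_size 1) = [:: Leaf] :> seq motzkin.
Proof.
apply: perm_small_eq => //; apply: uniq_perm => // [|t]; first exact: fset_uniq.
rewrite mem_trees inE nverticesE; apply/eqP/eqP => [|->//].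
case: t => //= [u|l r] /eqP; rewrite eqSS ?size_cat !size_map.
  by have := nil_addresses u; case: addresses.
by have := nil_addresses l; case: addresses.
Qed.

(** Here [n] is the total size of the two subtrees, so the listed trees have [n.+1] vertices. *)
Definition binary_trees n := [seq Binary lr.1 lr.2 | i <- iota 0 n.+1, lr <-
  [seq (l, r) | l <- fset_set (trees_of_size i),
                r <- fset_set (trees_of_size (n - i))]].

Lemma mem_binary_trees n t : (t \in binary_trees n) =
  if t is Binary l r then (nvertices l + nvertices r == n)%N else false.
Proof.
apply/(@allpairsPdep nat (fun=> (motzkin * motzkin)%type))/idP.
  move=> [i [? []]]; rewrite mem_iota /= add0n ltnS => iN.
  move=> /allpairsP[[l r] /= [+ + ->] ->] /=; rewrite !mem_trees.
  by move=> /eqP-> /eqP->; rewrite subnKC.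
case: t => // l r /eqP lrn; exists (nvertices l), (l, r); split=> //.
  by rewrite mem_iota /= add0n ltnS -lrn leq_addr.
by apply/allpairsP; exists (l, r); rewrite /= !mem_trees -lrn addKn !eqxx.
Qed.

Lemma uniq_binary_trees n : uniq (binary_trees n).
Proof.
apply: (@allpairs_uniq_dep nat (fun=> (motzkin * motzkin)%type)).
- exact: iota_uniq.
- move=> i _; apply: allpairs_uniq; rewrite ?fset_uniq //.
  by move=> [? ?] [? ?] _ _.
move=> p q /(@allpairsPdep nat (fun=> (motzkin * motzkin)%type))[i [lr [? + ->]]].
move=> + /(@allpairsPdep nat (fun=> (motzkin * motzkin)%type))[j [lr' [? + ->]]].
move=> /allpairsP[[a b] /= [+ _ ->]] /allpairsP[[a' b'] /= [+ _ ->]].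
by rewrite !mem_trees => /eqP ai /eqP aj [aE bE]; rewrite -ai -aj aE bE.
Qed.

Lemma treesSS n : perm_eq (fset_set (trees_of_size n.+2))
  ([seq Unary u | u <- fset_set (trees_of_size n.+1)] ++ binary_trees n.+1).
Proof.
apply: uniq_perm; first exact: fset_uniq.
  rewrite cat_uniq map_inj_uniq ?fset_uniq ?uniq_binary_trees /=; last first.
    by move=> ? ? [].
  rewrite andbT; apply/hasPn => t; rewrite mem_binary_trees.
  by case: t => // l r _; apply/mapP => -[].
move=> t; rewrite mem_trees mem_cat mem_binary_trees.
case: t => [|u|l r].
- by rewrite nverticesE; apply/esym/negP => /orP[/mapP[]|].
- rewrite nvertices_Unary eqSS orbF mem_map ?mem_trees //.
  by move=> ? ? [].
- by rewrite nvertices_Binary eqSS; case: eqP; rewrite ?orbT ?orbF //;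
  move=> _; apply/esym/negP => /mapP[].
Qed.

(** * Root decomposition of weighted generating functions *)

Section TreeGF.
Variable R : comNzRingType.
Implicit Types (f g : motzkin -> R) (h : motzkin -> motzkin -> R).

Definition tree_gf f : fps R :=
  fun n => \sum_(t <- fset_set (trees_of_size n)) f t.

Definition tree_pair_gf h : fps R := fun n => \sum_(i < n.+1)
  \sum_(l <- fset_set (trees_of_size i))
    \sum_(r <- fset_set (trees_of_size (n - i))) h l r.

(** The factor [X] accounts for the root; the summands are the cases of a leaf, a unary and a binary
    root. A natural number [a] lets [a%:R] be read both in [R] and as a constant series. *)
Lemma tree_gfE f (a : nat) : f Leaf = a%:R -> tree_gf f =
  fpsX R * (a%:R + tree_gf (f \o Unary)
              + tree_pair_gf (fun l r => f (Binary l r))).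
Proof.
move=> fL; apply/funext => n; rewrite coef_fpsXM.
case: n => [|[|n]]; rewrite ?coef_fpsD ?coef_fpsMn ?coef_fps1 /tree_gf.
- by rewrite trees0 big_nil.
- rewrite trees1 trees0 big_nil big_seq1 fL addr0 /tree_pair_gf big_ord1.
  by rewrite trees0 big_nil addr0.
rewrite (perm_big _ (treesSS n)) big_cat big_map mul0rn add0r; congr (_ + _).
rewrite big_allpairs_dep (_ : iota 0 _ = index_iota 0 n.+2) // big_mkord.
apply: eq_bigr => i _.
by rewrite big_allpairs.
Qed.

Lemma tree_gfD f g : tree_gf (fun t => f t + g t) = tree_gf f + tree_gf g.
Proof. by apply/funext => n; rewrite coef_fpsD /tree_gf big_split. Qed.

Lemma tree_pair_gfD h h' : tree_pair_gf (fun l r => h l r + h' l r) =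
  tree_pair_gf h + tree_pair_gf h'.
Proof.
apply/funext => n; rewrite coef_fpsD /tree_pair_gf -big_split.
apply: eq_bigr => i _; rewrite -big_split; apply: eq_bigr => l _.
by rewrite -big_split.
Qed.

Lemma tree_pair_gfM f g :
  tree_pair_gf (fun l r => f l * g r) = tree_gf f * tree_gf g.
Proof.
apply/funext => n; rewrite coef_fpsM; apply: eq_bigr => i _.
by rewrite /tree_gf mulr_suml; apply: eq_bigr => l _; rewrite mulr_sumr.
Qed.

Definition rank_ind k t : R := (k <= root_rank t)%:R.

Definition motzkin_gf : fps R := tree_gf (fun=> 1).
Definition rank_gf k : fps R := tree_gf (rank_ind k).
Definition protected_gf k : fps R := tree_gf (fun t => (num_protected k t)%:R).

Local Notation X := (fpsX R).
Local Notation M := motzkin_gf.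

Lemma motzkin_gf_coef n : M n = (motzkin_count n)%:R.
Proof. by rewrite /M /tree_gf big_const_seq count_predT iter_addr_0. Qed.

Lemma protected_gf_coef k n : protected_gf k n = (protected_count k n)%:R.
Proof. by rewrite protected_countE natr_sum. Qed.

Lemma motzkin_gfE : M = X * (1 + M + M ^+ 2).
Proof.
rewrite {1}/M (@tree_gfE _ 1) // expr2 -tree_pair_gfM; congr (_ * (_ + _)).
by congr tree_pair_gf; do 2!apply/funext => ?; rewrite mulr1.
Qed.

Lemma rank_gf0 : rank_gf 0 = M.
Proof. by []. Qed.

(** A leaf contributes nothing, and a minimum is at least [k] exactly when both ranks are, so the
    indicator of a binary root factors. *)
Lemma rank_gfS k : rank_gf k.+1 = X * (rank_gf k + rank_gf k ^+ 2).
Proof.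
rewrite {1}/rank_gf (@tree_gfE _ 0) // add0r expr2 -tree_pair_gfM.
congr (_ * (_ + _)); congr tree_pair_gf; do 2!apply/funext => ?.
by rewrite /rank_ind /= ltnS leq_min -natrM mulnb.
Qed.

(** The marked vertex is the root, or lies below an only child, or lies in one of two subtrees while
    the other is arbitrary, whence the factor [M] and the 2. *)
Lemma protected_gfE k :
  protected_gf k = rank_gf k + X * protected_gf k + (X * M * protected_gf k) *+ 2.
Proof.
pose f t : R := (num_protected k t)%:R.
rewrite {1}/protected_gf (@tree_gfE _ (k == 0%N)); last first.
  by rewrite /num_protected /= leqn0 addn0.
rewrite (_ : _ \o Unary = fun u => rank_ind k (Unary u) + f u); last first.
  by apply/funext => u /=; rewrite num_protected_Unary natrD.
have -> : tree_pair_gf (fun l r => (num_protected k (Binary l r))%:R) =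
    tree_pair_gf (fun l r => rank_ind k (Binary l r) + (f l * 1 + 1 * f r)).
  congr tree_pair_gf; do 2!apply/funext => ?.
  by rewrite num_protected_Binary !natrD mulr1 mul1r.
rewrite tree_gfD !tree_pair_gfD !tree_pair_gfM.
(* Expanding [rank_gf k] at the root too makes the root indicators on both sides match. *)
rewrite /rank_gf (@tree_gfE (rank_ind k) (k == 0%N)); last first.
  by rewrite /rank_ind leqn0.
rewrite /f -/(protected_gf k) -/M /comp. ring.
Qed.

End TreeGF.

(** * Asymptotics of contexts *)

Section ContextGF.
Variable R : realType.

Local Notation X := (fpsX R).
Local Notation M := (motzkin_gf R).
Local Notation P k := (protected_gf R k).

Definition geometric_fps : fps R := fun=> 1.

Lemma geometric_fpsE : geometric_fps * (1 - X) = 1.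
Proof.
apply/funext => n; rewrite mulrC mulrBl mul1r coef_fpsB coef_fpsXM coef_fps1.
by case: n => [|n]; rewrite ?subr0 ?subrr.
Qed.

(* Closed form: [context_gf = 1 / (1 - X - 2 X M)]; its [n]-th coefficient counts
   the trees with a marked leaf and [n] other vertices. *)
Definition context_gf : fps R := geometric_fps * (1 + (X * P 0) *+ 2).
Local Notation C := context_gf.

Lemma context_gfE : C = 1 + X * C + (X * P 0) *+ 2.
Proof.
have H : C * (1 - X) = 1 + (X * P 0) *+ 2.
  by rewrite /C mulrAC geometric_fpsE mul1r.
by rewrite addrAC -H; ring.
Qed.

Lemma mul_protected_gf k : (1 - X - (X * M) *+ 2) * P k = rank_gf R k.
Proof.
by have /eqP := protected_gfE R k; rewrite -addrA -subr_eq => /eqP <-; ring.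
Qed.

(** With [D = 1 - X - 2 X M] one has [D P_0 = M], so [D (1 + 2 X P_0) = D + 2 X M = 1 - X]. This
    shows that the explicit series [C] is the inverse of [D]. *)
Lemma mul_context_gf : (1 - X - (X * M) *+ 2) * C = 1.
Proof.
have H : (1 - X - (X * M) *+ 2) * (1 + (X * P 0) *+ 2) = 1 - X.
  have -> : (1 - X - (X * M) *+ 2) * (1 + (X * P 0) *+ 2) =
    1 - X - (X * M) *+ 2 + (X * ((1 - X - (X * M) *+ 2) * P 0)) *+ 2 by ring.
  by rewrite mul_protected_gf rank_gf0 subrK.
by rewrite /C mulrCA H geometric_fpsE.
Qed.

Lemma protected_gf_rank k : P k = rank_gf R k * C.
Proof. by rewrite -mul_protected_gf mulrAC mul_context_gf mul1r. Qed.

Lemma motzkin_gf_context : P 0 = M * C.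
Proof. by rewrite protected_gf_rank rank_gf0. Qed.

(** Completing the square in [X M^2 + (X - 1) M + X = 0]: the square of [1 - X - 2 X M] is the
    discriminant [(1 - X)^2 - 4 X^2]. *)
Lemma context_gf_sqr : (1 - X *+ 2 - X ^+ 2 *+ 3) * C ^+ 2 = 1.
Proof.
have -> : 1 - X *+ 2 - X ^+ 2 *+ 3 = (1 - X - (X * M) *+ 2) ^+ 2 +
    (X * M - X * (X * (1 + M + M ^+ 2))) *+ 4 by ring.
by rewrite -motzkin_gfE subrr mul0rn addr0 -exprMn mul_context_gf expr1n.
Qed.

Lemma context_gf_theta :
  (1 - X *+ 2 - X ^+ 2 *+ 3) * fps_theta C = (X + X ^+ 2 *+ 3) * C.
Proof.
move: mul_context_gf context_gf_sqr; move: context_gf => c CE C2.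
(* Only sums and products occur in this form of the relation, so the rules for [fps_theta] apply
   directly. *)
have : c * c = 1 + (X + X) * (c * c) + (X * X + X * X + X * X) * (c * c).
  by rewrite -{1}C2; ring.
move=> /(congr1 (@fps_theta R)).
rewrite !(fps_thetaD, fps_thetaM) fps_theta1 !fps_thetaX => /eqP.
rewrite -subr_eq0 => /eqP tC.
(* Differentiation gives this identity multiplied by [c]; that factor is cancelled with its inverse
   from [CE]. *)
have H : ((1 - X *+ 2 - X ^+ 2 *+ 3) * fps_theta c) *+ 2 =
    ((X + X ^+ 2 *+ 3) * c) *+ 2.
  apply/eqP; rewrite -subr_eq0 -[_ - _]mul1r -{1}CE; apply/eqP.
  by rewrite -[RHS](mulr0 (1 - X - (X * M) *+ 2)) -tC; ring.
(* The factor 2 is cancelled coefficient by coefficient, in [R]. *)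
apply/funext => n; move: (congr1 (fun f => f n) H).
by rewrite /= !coef_fpsMn => /eqP; rewrite eqrMn2r => /eqP.
Qed.

Lemma context_gf_rec n : n.+2%:R * C n.+2 =
  (2 * n%:R + 3) * C n.+1 + 3 * (n%:R + 1) * C n.
Proof.
have := congr1 (fun f => f n.+2) context_gf_theta.
have -> : (1 - X *+ 2 - X ^+ 2 *+ 3) * fps_theta C =
  fps_theta C - X * fps_theta C *+ 2 - X * (X * fps_theta C) *+ 3 by ring.
have -> : (X + X ^+ 2 *+ 3) * C = X * C + X * (X * C) *+ 3 by ring.
rewrite /= !coef_fpsB coef_fpsD !coef_fpsMn !coef_fpsXM /fps_theta.
by rewrite -![n.+1%:R]natr1 -![n.+2%:R]natr1 -![n.+1%:R]natr1; lra.
Qed.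

Lemma context_gf0 : C 0%N = 1.
Proof.
rewrite context_gfE !coef_fpsD coef_fpsMn !coef_fpsXM coef_fps1.
by rewrite mul0rn !addr0.
Qed.

Lemma context_gfS n : C n.+1 = C n + 2 * P 0 n.
Proof.
rewrite {1}context_gfE !coef_fpsD coef_fpsMn !coef_fpsXM coef_fps1 /=.
by rewrite add0r mulr_natl.
Qed.

Lemma context_gf_gt0 n : 0 < C n.
Proof.
elim: n => [|n IHn]; first by rewrite context_gf0.
by rewrite context_gfS ltr_wpDr // protected_gf_coef mulr_ge0.
Qed.

(** The two bounds need a joint induction: through the recurrence, the upper bound at [n] gives the
    lower one at [n.+1], and the lower bound at [n] gives the upper one. *)
Lemma context_gf_bounds n :
  (3 * n%:R + 1) * C n <= n.+1%:R * C n.+1 /\ C n.+1 <= 3 * C n.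
Proof.
elim: n => [|n [IHl IHu]].
  have P00 : P 0 0%N = 0 by rewrite motzkin_gf_context coef_fpsM big_ord1
    motzkin_gfE coef_fpsXM mul0r.
  by rewrite context_gfS context_gf0 P00; split; lra.
have C0 := context_gf_gt0 n; have C1 := context_gf_gt0 n.+1.
have := context_gf_rec n; move: IHl IHu.
rewrite -![n.+2%:R]natr1 -![n.+1%:R]natr1.
have : 0 <= n%:R :> R by []; move: (n%:R) => x x0 IHl IHu rec.
split; first by rewrite rec; nra.
have x2 : 0 < x + 2 by lra.
rewrite -(ler_pM2l x2).
(* What the recurrence leaves of the upper bound. After multiplication by [x + 1] it follows from
   the lower bound, since [(x + 3) (3 x + 1) - 3 (x + 1)^2 = 4 x]. *)
suff : 3 * (x + 1) * C n <= (x + 3) * C n.+1 by lra.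
rewrite -(@ler_pM2l _ (x + 1)); last by lra.
have : (x + 3) * ((3 * x + 1) * C n) <= (x + 3) * ((x + 1) * C n.+1).
  by rewrite ler_wpM2l //; lra.
by have := mulr_ge0 x0 (ltW C0); lra.
Qed.

Lemma context_gf_ratio : C n.+1 / C n @[n --> \oo] --> (3 : R).
Proof.
(* As [harmonic n] is [1 / (n + 1)], this is [(3 n + 1) / (n + 1)], the lower bound just proved. *)
have lo : 3 - 2 * harmonic n @[n --> \oo] --> (3 : R).
  rewrite -[X in _ --> X]subr0 -[X in _ - X](mulr0 2).
  apply: cvgB; first exact: cvg_cst.
  by apply: cvgM; [exact: cvg_cst|exact: cvg_harmonic].
apply: squeeze_cvgr lo (cvg_cst _); apply: nearW => n /=.
have [lC uC] := context_gf_bounds n; have C0 := context_gf_gt0 n.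
rewrite ler_pdivrMr // uC andbT ler_pdivlMr //.
have n0 : 0 < n.+1%:R :> R by [].
rewrite -(ler_pM2l n0); apply: le_trans lC.
rewrite mulrA ler_wpM2r ?(ltW C0) // mulrBr mulrCA /harmonic divff ?gt_eqF //.
by rewrite -natr1; lra.
Qed.

Lemma context_gf_protected0 j :
  C (n - j)%N / P 0 n @[n --> \oo] --> (3^-1 ^+ j : R).
Proof.
(* Shifting by [j] removes the truncated subtraction. *)
suff H : C n / P 0%N (n + j)%N @[n --> \oo] --> (3^-1 ^+ j : R).
  rewrite -(cvg_shiftn j) /=.
  by under eq_fun do rewrite addnK.
elim: j => [|j IHj].
  (* At [n = 0] both sides are 0 by the convention for division by zero. *)
  have -> : (fun n => C n / P 0%N (n + 0)%N) = (fun n => 2 / (C n.+1 / C n - 1)).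
    apply/funext => n; rewrite addn0 context_gfS.
    have C0 : C n != 0 by rewrite gt_eqF ?context_gf_gt0.
    have -> : (C n + 2 * P 0 n) / C n - 1 = 2 * (P 0 n / C n) by field.
    by rewrite invfM invf_div mulVKf ?pnatr_eq0.
  have e : 3 - 1 = 2 :> R by ring.
  have -> : 3^-1 ^+ 0 = 2 / (3 - 1) :> R by rewrite e divff ?pnatr_eq0.
  apply: cvgM; first exact: cvg_cst.
  apply: cvgV; first by rewrite e pnatr_eq0.
  by apply: cvgB; [exact: context_gf_ratio|exact: cvg_cst].
have {}IHj : C n.+1 / P 0%N (n.+1 + j)%N @[n --> \oo] --> (3^-1 ^+ j : R).
  by rewrite (cvg_shiftS (fun n => C n / P 0%N (n + j)%N)).
(* Each further shift contributes one factor [C n / C n.+1], which tends to [1 / 3]. *)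
have -> : (fun n => C n / P 0%N (n + j.+1)%N) =
    (fun n => (C n.+1 / C n)^-1 * (C n.+1 / P 0%N (n.+1 + j)%N)).
  apply/funext => n; rewrite addSnnS invf_div mulrA divfK //.
  by rewrite gt_eqF ?context_gf_gt0.
rewrite exprS; apply: cvgM => //; apply: cvgV; first by rewrite pnatr_eq0.
exact: context_gf_ratio.
Qed.

End ContextGF.

(** * Evaluation of power series *)

Section FpsEval.
Variable R : realType.
Implicit Types (f g : fps R) (x : R).

Definition fps_psum f x : R^nat := fun n => \sum_(k < n) f k * x ^+ k.

Lemma fps_psumD f g x n :
  fps_psum (f + g) x n = fps_psum f x n + fps_psum g x n.
Proof.
by rewrite /fps_psum -big_split; apply: eq_bigr => i _; rewrite coef_fpsD mulrDl.
Qed.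

Lemma fps_psumXM f x n : fps_psum (fpsX R * f) x n.+1 = x * fps_psum f x n.
Proof.
rewrite /fps_psum big_ord_recl coef_fpsXM mul0r add0r mulr_sumr.
by apply: eq_bigr => i _; rewrite coef_fpsXM exprS mulrCA.
Qed.

(** The terms of the double sum over the triangle [i + j < n], grouped by [i]. *)
Lemma fps_psumM f g x n : fps_psum (f * g) x n =
  \sum_(i < n) f i * x ^+ i * fps_psum g x (n - i)%N.
Proof.
elim: n => [|n IHn]; first by rewrite /fps_psum !big_ord0.
rewrite /fps_psum big_ord_recr /= -/(fps_psum _ _ _) IHn.
rewrite [RHS](eq_bigr (fun i : 'I_n.+1 => f i * x ^+ i * fps_psum g x (n - i)%N
    + f i * g (n - i)%N * x ^+ n)); last first.
  move=> i _; have le_in : (i <= n)%N by rewrite -ltnS.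
  rewrite subSn // {1}/fps_psum big_ord_recr /= -/(fps_psum _ _ _) mulrDr.
  congr (_ + _); rewrite mulrACA -exprD subnKC //.
rewrite big_split big_ord_recr /= subnn {3}/fps_psum big_ord0 mulr0 addr0.
by rewrite coef_fpsM mulr_suml.
Qed.

Section Nonnegative.
Variables (f : fps R) (x : R).
Hypotheses (f0 : forall n, 0 <= f n) (x0 : 0 <= x).

Lemma fps_term_ge0 n : 0 <= f n * x ^+ n.
Proof. by rewrite mulr_ge0 ?exprn_ge0. Qed.

Lemma fps_psum_ge0 n : 0 <= fps_psum f x n.
Proof. by apply: sumr_ge0 => i _; exact: fps_term_ge0. Qed.

Lemma fps_psum_homo : {homo fps_psum f x : m n / (m <= n)%N >-> m <= n}.
Proof.
apply: homo_leq => [//|? ? ?|n]; first exact: le_trans.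
by rewrite /fps_psum big_ord_recr lerDl fps_term_ge0.
Qed.

End Nonnegative.

(** The triangle [i + j < n] lies in the square of side [n]. *)
Lemma fps_psumM_le f g x n : (forall n, 0 <= f n) -> (forall n, 0 <= g n) ->
  0 <= x -> fps_psum (f * g) x n <= fps_psum f x n * fps_psum g x n.
Proof.
move=> f0 g0 x0; rewrite fps_psumM mulr_suml; apply: ler_sum => i _.
by rewrite ler_wpM2l ?fps_term_ge0 // fps_psum_homo // leq_subr.
Qed.

(** The triangle [i + j < n] contains the square of side [n %/ 2]. *)
Lemma fps_psumM_ge f g x n : (forall n, 0 <= f n) -> (forall n, 0 <= g n) ->
  0 <= x -> fps_psum f x (n %/ 2)%N * fps_psum g x (n %/ 2)%N <= fps_psum (f * g) x n.
Proof.
move=> f0 g0 x0; rewrite fps_psumM mulr_suml.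
rewrite -(big_mkord xpredT (fun i => f i * x ^+ i * fps_psum g x (n - i)%N)).
rewrite (big_cat_nat (n := (n %/ 2)%N)) //=; last by lia.
rewrite big_mkord ler_wpDr //.
  by apply: sumr_ge0 => i _; rewrite mulr_ge0 ?fps_term_ge0 ?fps_psum_ge0.
apply: ler_sum => i _.
rewrite ler_wpM2l ?fps_term_ge0 // fps_psum_homo //.
by have := ltn_ord i; lia.
Qed.

Lemma fps_psumM_cvg f g x (a b : R) : (forall n, 0 <= f n) -> (forall n, 0 <= g n) ->
  0 <= x -> fps_psum f x @ \oo --> a -> fps_psum g x @ \oo --> b ->
  fps_psum (f * g) x @ \oo --> a * b.
Proof.
move=> f0 g0 x0 fa gb.
have half h (c : R) : fps_psum h x @ \oo --> c ->
    fps_psum h x (n %/ 2)%N @[n --> \oo] --> c.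
  by move=> hc; apply: cvg_comp hc; exact: cvg_divnr.
apply: squeeze_cvgr (cvgM (half _ _ fa) (half _ _ gb)) (cvgM fa gb).
by apply: nearW => n; rewrite /= fps_psumM_le // fps_psumM_ge.
Qed.

End FpsEval.

(* Scheffe's lemma: the weights [m j * c (n - j) / N n] sum to one over [j] and
   converge pointwise to weights summing to one, hence converge in [l^1], which
   lets the limit pass to the sums weighted by any [0 <= r <= m]. *)
Lemma fpsM_ratio_cvg (R : realType) (r m c : fps R) (x l : R) :
    (forall n, 0 <= r n <= m n) -> (forall n, 0 <= c n) ->
    (\forall n \near \oo, 0 < (m * c) n) ->
    (forall j, c (n - j)%N / (m * c) n @[n --> \oo] --> x ^+ j) ->
    fps_psum m x @ \oo --> (1 : R) -> fps_psum r x @ \oo --> l ->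
  (r * c) n / (m * c) n @[n --> \oo] --> l.
Proof.
move=> rm c0 N0 cx m1 rl; apply/cvgrPdist_le => e e0.
have psum_cvg (h : fps R) K :
    \sum_(j < K) h j * (c (n - j)%N / (m * c) n) @[n --> \oo] --> fps_psum h x K.
  rewrite /fps_psum; apply: cvg_big => [|j _].
    exact: add_continuous.
  by apply: cvgM; [exact: cvg_cst|exact: cx].
(* Two errors of [e / 4] separate [l] from the head [B]. Two more bound the tail [tm] by [e / 2],
   and hence [tr], which lies between 0 and [tm]. *)
have e4 : 0 < e / 4 by lra.
have [K [mK rK]] : exists K, `|1 - fps_psum m x K| <= e / 4 /\
    `|l - fps_psum r x K| <= e / 4.
  have /cvgrPdist_le/(_ _ e4) mK := m1; have /cvgrPdist_le/(_ _ e4) rK := rl.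
  have [K [? ?]] := filter_ex (filterI mK rK).
  by exists K.
have /cvgrPdist_le/(_ _ e4) mKn := psum_cvg m K.
have /cvgrPdist_le/(_ _ e4) rKn := psum_cvg r K.
near=> n.
have Kn : (K <= n.+1)%N by near: n; apply: filterS (nbhs_infty_ge K) => n /leqW.
have Nn : 0 < (m * c) n by near: n.
have mKn' : `|fps_psum m x K - \sum_(j < K) m j * (c (n - j)%N / (m * c) n)| <= e / 4.
  by near: n.
have rKn' : `|fps_psum r x K - \sum_(j < K) r j * (c (n - j)%N / (m * c) n)| <= e / 4.
  by near: n.
have split_sum (h : fps R) : (h * c) n / (m * c) n =
    \sum_(j < K) h j * (c (n - j)%N / (m * c) n) +
    \sum_(K <= j < n.+1) h j * (c (n - j)%N / (m * c) n).
  rewrite coef_fpsM mulr_suml; under eq_bigr do rewrite -mulrA.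
  by rewrite -!(big_mkord xpredT (fun j => h j * (c (n - j)%N / (m * c) n)))
    (big_cat_nat (n := K)).
(* For [h = m] the ratio is 1, so [A] and [tm] add up to 1. *)
have := split_sum m; rewrite divff ?gt_eqF // split_sum.
set A := \sum_(j < K) _ in mKn' *; set B := \sum_(j < K) _ in rKn' *.
set tm := \sum_(K <= j < _) _; set tr := \sum_(K <= j < _) _.
have cN j : 0 <= c (n - j)%N / (m * c) n by rewrite divr_ge0 // ltW.
have tr0 : 0 <= tr <= tm.
  apply/andP; split.
    apply: sumr_ge0 => j _; rewrite mulr_ge0 //.
    by have /andP[] := rm j.
  apply: ler_sum => j _; rewrite ler_wpM2r //.
  by have /andP[] := rm j.
move: tr0 mK rK mKn' rKn'; rewrite !ler_norml.
move: (fps_psum m x K) (fps_psum r x K) => u v; clearbody A B tm tr.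
lra.
Unshelve. all: by end_near. Qed.

(** * The limits *)

Section Evaluation.
Variable R : realType.

Lemma motzkin_gf_ge0 n : 0 <= motzkin_gf R n.
Proof. by rewrite motzkin_gf_coef. Qed.

Lemma rank_gf_bounds k n : 0 <= rank_gf R k n <= motzkin_gf R n.
Proof.
apply/andP; split; first by apply: sumr_ge0 => t _; rewrite /rank_ind.
by apply: ler_sum => t _; rewrite /rank_ind lern1 leq_b1.
Qed.

Lemma fps_psum1 (x : R) n : fps_psum 1 x n.+1 = 1.
Proof.
rewrite /fps_psum big_ord_recl coef_fps1 mul1r expr0 big1 ?addr0 // => i _.
by rewrite coef_fps1 mul0r.
Qed.

Lemma motzkin_psumS n : fps_psum (motzkin_gf R) 3^-1 n.+1 = 3^-1 *
  (fps_psum 1 3^-1 n + fps_psum (motzkin_gf R) 3^-1 n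
   + fps_psum (motzkin_gf R ^+ 2) 3^-1 n).
Proof. by rewrite {1}motzkin_gfE fps_psumXM !fps_psumD. Qed.

(** The map [s -> (1 + s + s^2) / 3] is increasing on nonnegative [s] and fixes 1, so the partial
    sums never exceed 1. *)
Lemma motzkin_psum_le1 n : fps_psum (motzkin_gf R) 3^-1 n <= 1.
Proof.
elim: n => [|n IHn]; first by rewrite /fps_psum big_ord0.
have M0 := motzkin_gf_ge0; have x0 : 0 <= 3^-1 :> R by [].
rewrite motzkin_psumS.
have := fps_psumM_le n M0 M0 x0; rewrite -expr2.
have : fps_psum 1 3^-1 n <= 1 :> R.
  by case: n {IHn} => [|n]; rewrite ?fps_psum1 // /fps_psum big_ord0.
have := fps_psum_ge0 M0 x0 n; move: IHn.
move: (fps_psum (_ ^+ 2) _ _) (fps_psum 1 _ _) (fps_psum _ _ _) => a b c.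
by nra.
Qed.

Lemma rank_psum_cvg k : cvgn (fps_psum (rank_gf R k) 3^-1).
Proof.
apply: nondecreasing_is_cvgn.
  by apply: fps_psum_homo => // n; have /andP[] := rank_gf_bounds k n.
exists 1 => _ [n _ <-]; apply: le_trans (motzkin_psum_le1 n).
apply: ler_sum => i _; rewrite ler_wpM2r ?exprn_ge0 //.
by have /andP[] := rank_gf_bounds k i.
Qed.

Definition rank_value k : R := limn (fps_psum (rank_gf R k) 3^-1).

Lemma rank_sqr_cvg k :
  fps_psum (rank_gf R k ^+ 2) 3^-1 @ \oo --> rank_value k ^+ 2.
Proof.
have r0 n : 0 <= rank_gf R k n by have /andP[] := rank_gf_bounds k n.
by rewrite !expr2; apply: fps_psumM_cvg => //; exact: rank_psum_cvg.
Qed.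

Lemma rank_valueS k :
  rank_value k.+1 = 1 / 3 * rank_value k + 1 / 3 * rank_value k ^+ 2.
Proof.
rewrite -mulrDr div1r; apply: cvg_lim => //; rewrite -cvg_shiftS /=.
under eq_fun do rewrite rank_gfS fps_psumXM fps_psumD.
apply: cvgM; first exact: cvg_cst.
by apply: cvgD; [exact: rank_psum_cvg|exact: rank_sqr_cvg].
Qed.

(** At [1/3] the discriminant [1 - 2 X - 3 X^2] vanishes, so the equation for [M] has the double
    root 1 and the limit is forced. *)
Lemma rank_value0 : rank_value 0 = 1.
Proof.
have E : rank_value 0 = 3^-1 * (1 + rank_value 0 + rank_value 0 ^+ 2).
  rewrite {1}/rank_value rank_gf0; apply: cvg_lim => //; rewrite -cvg_shiftS /=.
  under eq_fun do rewrite motzkin_psumS.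
  apply: cvgM; first exact: cvg_cst.
  apply: cvgD; last exact: rank_sqr_cvg.
  apply: cvgD; last exact: rank_psum_cvg.
  (* The partial sums of the series 1 equal 1 except for the empty one, which the shift skips. *)
  rewrite -cvg_shiftS /=; under eq_fun do rewrite fps_psum1.
  exact: cvg_cst.
have /eqP : (rank_value 0 - 1) ^+ 2 = 0 by move: E; lra.
by rewrite expf_eq0 /= subr_eq0 => /eqP.
Qed.

Lemma protected_count0 n : protected_count 0 n = (n * motzkin_count n)%N.
Proof.
rewrite protected_countE (eq_big_seq (fun=> n)).
  by rewrite big_const_seq count_predT iter_addn_0.
by move=> t; rewrite mem_trees num_protected0 => /eqP.
Qed.

Lemma protected_ratioE k n :
  protected_ratio R k n = protected_gf R k n / protected_gf R 0 n.
Proof. by rewrite !protected_gf_coef protected_count0 natrM. Qed.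

Lemma protected_gf0_gt0 n : (0 < n)%N -> 0 < protected_gf R 0 n.
Proof.
case: n => // n _; have M0 := motzkin_gf_ge0.
have M1 : motzkin_gf R 1%N = 1 by rewrite /motzkin_gf /tree_gf trees1 big_seq1.
(* The single-vertex tree gives the term [M_1 C_n], which is positive; the other terms are
   nonnegative. *)
rewrite motzkin_gf_context coef_fpsM (bigD1 (inord 1)) //= inordK //.
rewrite M1 mul1r ltr_wpDr ?context_gf_gt0 //.
by apply: sumr_ge0 => i _; rewrite mulr_ge0 // ltW ?context_gf_gt0.
Qed.

Lemma protected_ratio_cvg k : protected_ratio R k @ \oo --> rank_value k.
Proof.
rewrite (_ : protected_ratio R k = fun n =>
   (rank_gf R k * context_gf R) n / (motzkin_gf R * context_gf R) n); last first.
  by apply/funext => n; rewrite protected_ratioE -motzkin_gf_context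
    -protected_gf_rank.
apply: (@fpsM_ratio_cvg _ _ _ _ 3^-1).
- exact: rank_gf_bounds.
- by move=> n; rewrite ltW ?context_gf_gt0.
- rewrite -motzkin_gf_context.
  by apply: filterS (nbhs_infty_gt 0) => n; exact: protected_gf0_gt0.
- by move=> j; rewrite -motzkin_gf_context; exact: context_gf_protected0.
- have := @rank_psum_cvg 0; rewrite -/(rank_value 0) rank_value0 rank_gf0.
  exact.
- exact: rank_psum_cvg.
Qed.

End Evaluation.

Theorem theorem3p3 (R : realType) :
  (forall k : nat, cvgn (protected_ratio R k)) /\
  (forall k : nat, (1 <= k)%N ->
     protected_proportion R k =
       1 / 3 * protected_proportion R k.-1
       + 1 / 3 * protected_proportion R k.-1 ^+ 2).
Proof.
have pE k : protected_proportion R k = rank_value R k.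
  by apply: cvg_lim => //; exact: protected_ratio_cvg.
split=> [k|[//|k] _]; first by apply: cvgP; exact: protected_ratio_cvg.
by rewrite !pE rank_valueS.
Qed.
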